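(* In addition to the standing assumptions, assume that $\mu$ and $\nu$ are absolutely continuous with respect to Lebesgue measure, and that for every $x\in X$ the map $z\mapsto D_xu(x,z)$ is injective on $Z_0$ and for every $y\in Y$ the map $z\mapsto D_yv(y,z)$ is injective on $Z_0$, i.e. $$D_xu(x,z_1)=D_xu(x,z_2)\Rightarrow z_1=z_2,\qquad D_yv(y,z_1)=D_yv(y,z_2)\Rightarrow z_1=z_2\quad(z_1,z_2\in Z_0).$$ Then every equilibrium is pure: for $\mu$-a.e. $x$ the set $D(x)\cap Z_0$ has at most one point, and for $\nu$-a.e. $y$ the set $S(y)\cap Z_0$ has at most one point.
   Context: Standing setting. $X\subset\mathbb R^{d_1}$, $Y\subset\mathbb R^{d_2}$, $Z_0\subset\mathbb R^{d_3}$ compact; $\mu,\nu$ finite nonnegative Borel measures on $X,Y$. $u$ is a continuous real function on a neighbourhood of $X\times Z_0$, differentiable in $x$ with $D_xu$ continuous in $(x,z)$; $v$ is a continuous real function on a neighbourhood of $Y\times Z_0$, differentiable in $y$ with $D_yv$ continuous in $(y,z)$. $Z=Z_0\cup\{\varnothing_d\}\cup\{\varnothing_s\}$ with two distinct isolated extra points; $u(x,\varnothing_d)=0$, $u(x,\varnothing_s)=-1$, $v(y,\varnothing_s)=0$, $v(y,\varnothing_d)=1$. $b(z)=\max_x u(x,z)$, $a(z)=\min_y v(y,z)$, $Z_1=\{z\in Z:a(z)\le b(z)\}$. A price system is a continuous $p:Z\to\mathbb R$ with $p(\varnothing_d)=p(\varnothing_s)=0$, admissible if $a\le p\le b$ on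 $Z_1$. $D(x)=\arg\max_{z\in Z}\{u(x,z)-p(z)\}$, $S(y)=\arg\min_{z\in Z}\{v(y,z)-p(z)\}$. A demand (resp. supply) distribution associated with $p$ is a positive Borel measure on $X\times Z$ (resp. $Y\times Z$) carried by the graph of $D$ (resp. $S$) with $X$-marginal $\mu$ (resp. $Y$-marginal $\nu$). An equilibrium is $(p,\alpha,\beta)$ with $p$ admissible, $\alpha,\beta$ associated demand and supply distributions, and equal $Z$-marginals on Borel subsets of $Z_0$. An equilibrium is pure if for $\mu$-a.e. $x$ the set $D(x)\cap Z_0$ has at most one point and for $\nu$-a.e. $y$ the set $S(y)\cap Z_0$ has at most one point. *)

(* Defs.v *)
From HB Require Import structures.
From mathcomp Require Import all_boot all_order all_algebra.
From mathcomp Require Import all_classical all_reals all_analysis.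
Set Implicit Arguments. Unset Strict Implicit. Unset Printing Implicit Defensive.
Import Order.TTheory GRing.Theory Num.Theory.
Import numFieldNormedType.Exports.
Local Open Scope classical_set_scope.
Local Open Scope ring_scope.

Definition borel (T : topologicalType) (A : set T) : Prop := <<s @open T>> A.

(* A finite nonnegative (countably additive) measure on the sigma-algebra S,
   given by its (real, since finite) values on the sets of S. *)
Definition fin_measure_on (R : realType) (T : Type) (S : set (set T)) (m : set T -> R) : Prop :=
  m set0 = 0 /\ (forall A, S A -> 0 <= m A) /\
  (forall F : nat -> set T, (forall k, S (F k)) -> trivIset setT F ->
     (fun n => \sum_(k < n) m (F k)) @ \oo --> m (\bigcup_k F k)).

Definition lebesgue_null (R : realType) (n : nat) (A : set 'rV[R]_n) : Prop :=
  forall eps : R, 0 < eps -> exists a b : nat -> 'rV[R]_n,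
    (forall k i, a k ord0 i <= b k ord0 i) /\
    A `<=` \bigcup_k [set x | forall i, a k ord0 i <= x ord0 i <= b k ord0 i] /\
    (forall N, \sum_(k < N) \prod_(i < n) (b k ord0 i - a k ord0 i) <= eps).

Definition abs_cont_leb (R : realType) (n : nat) (m : set 'rV[R]_n -> R) : Prop :=
  forall A, borel A -> lebesgue_null A -> m A = 0.

(* ---------- The space Z = Z0 u {void_d} u {void_s} ---------- *)

Inductive Zpt (T : Type) := Zin of T | Zd | Zs.
Arguments Zd {T}. Arguments Zs {T}.

Section Market.
Variables (R : realType) (d1 d2 d3 : nat).
Variables (X : set 'rV[R]_d1) (Y : set 'rV[R]_d2) (Z0 : set 'rV[R]_d3).
Variables (u : 'rV[R]_d1 -> 'rV[R]_d3 -> R) (v : 'rV[R]_d2 -> 'rV[R]_d3 -> R).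

Definition inZ (z : Zpt 'rV[R]_d3) : Prop :=
  match z with Zin z0 => Z0 z0 | _ => True end.

Definition uZ (x : 'rV[R]_d1) (z : Zpt 'rV[R]_d3) : R :=
  match z with Zin z0 => u x z0 | Zd => 0 | Zs => -1 end.
Definition vZ (y : 'rV[R]_d2) (z : Zpt 'rV[R]_d3) : R :=
  match z with Zin z0 => v y z0 | Zs => 0 | Zd => 1 end.

Definition bZ (z : Zpt 'rV[R]_d3) : R := sup [set uZ x z | x in X].
Definition aZ (z : Zpt 'rV[R]_d3) : R := inf [set vZ y z | y in Y].
Definition Z1 (z : Zpt 'rV[R]_d3) : Prop := inZ z /\ aZ z <= bZ z.

(* A price system: continuous on Z, zero at the two extra (isolated) points;
   it is given by its restriction p to Z0. *)
Definition pZ (p : 'rV[R]_d3 -> R) (z : Zpt 'rV[R]_d3) : R :=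
  match z with Zin z0 => p z0 | _ => 0 end.
Definition price_system (p : 'rV[R]_d3 -> R) : Prop := {within Z0, continuous p}.
Definition admissible (p : 'rV[R]_d3 -> R) : Prop :=
  price_system p /\ forall z, Z1 z -> aZ z <= pZ p z <= bZ z.

Definition Dset (p : 'rV[R]_d3 -> R) (x : 'rV[R]_d1) : set (Zpt 'rV[R]_d3) :=
  [set z | inZ z /\ forall z', inZ z' -> uZ x z' - pZ p z' <= uZ x z - pZ p z].
Definition Sset (p : 'rV[R]_d3 -> R) (y : 'rV[R]_d2) : set (Zpt 'rV[R]_d3) :=
  [set z | inZ z /\ forall z', inZ z' -> vZ y z - pZ p z <= vZ y z' - pZ p z'].

End Market.

(* Borel sets of R^n x Z (Z = Z0 plus two isolated points): E is Borel iff
   its part over the Euclidean points is Borel in R^n x R^d3 and its slices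
   over the two extra points are Borel in R^n. *)
Definition borelXZ (R : realType) (n d3 : nat)
  (E : set ('rV[R]_n * Zpt 'rV[R]_d3)) : Prop :=
  borel [set q : 'rV[R]_n * 'rV[R]_d3 | E (q.1, Zin q.2)] /\
  borel [set x : 'rV[R]_n | E (x, Zd)] /\
  borel [set x : 'rV[R]_n | E (x, Zs)].

Definition assoc_distribution (R : realType) (n d3 : nat) (W : set 'rV[R]_n)
  (F : 'rV[R]_n -> set (Zpt 'rV[R]_d3)) (m : set 'rV[R]_n -> R)
  (gamma : set ('rV[R]_n * Zpt 'rV[R]_d3) -> R) : Prop :=
  fin_measure_on (@borelXZ R n d3) gamma /\
  (exists E, borelXZ E /\ E `<=` [set q | W q.1 /\ F q.1 q.2] /\ gamma (~` E) = 0) /\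
  (forall A, borel A -> gamma [set q | A q.1] = m A).

Definition over (R : realType) (n d3 : nat) (B : set 'rV[R]_d3) :
  set ('rV[R]_n * Zpt 'rV[R]_d3) :=
  [set q | match q.2 with Zin z => B z | _ => False end].

Definition equilibrium (R : realType) (d1 d2 d3 : nat)
  (X : set 'rV[R]_d1) (Y : set 'rV[R]_d2) (Z0 : set 'rV[R]_d3)
  (mu : set 'rV[R]_d1 -> R) (nu : set 'rV[R]_d2 -> R)
  (u : 'rV[R]_d1 -> 'rV[R]_d3 -> R) (v : 'rV[R]_d2 -> 'rV[R]_d3 -> R)
  (p : 'rV[R]_d3 -> R)
  (alpha : set ('rV[R]_d1 * Zpt 'rV[R]_d3) -> R)
  (beta : set ('rV[R]_d2 * Zpt 'rV[R]_d3) -> R) : Prop :=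
  admissible X Y Z0 u v p /\
  assoc_distribution X (Dset Z0 u p) mu alpha /\
  assoc_distribution Y (Sset Z0 v p) nu beta /\
  (forall B, borel B -> B `<=` Z0 -> alpha (@over R d1 d3 B) = beta (@over R d2 d3 B)).

Definition pure_equilibrium (R : realType) (d1 d2 d3 : nat)
  (Z0 : set 'rV[R]_d3)
  (mu : set 'rV[R]_d1 -> R) (nu : set 'rV[R]_d2 -> R)
  (u : 'rV[R]_d1 -> 'rV[R]_d3 -> R) (v : 'rV[R]_d2 -> 'rV[R]_d3 -> R)
  (p : 'rV[R]_d3 -> R) : Prop :=
  (exists N, borel N /\ mu N = 0 /\ forall x, ~ N x ->
     forall z1 z2, Z0 z1 -> Z0 z2 -> Dset Z0 u p x (Zin z1) ->
       Dset Z0 u p x (Zin z2) -> z1 = z2) /\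
  (exists N, borel N /\ nu N = 0 /\ forall y, ~ N y ->
     forall z1 z2, Z0 z1 -> Z0 z2 -> Sset Z0 v p y (Zin z1) ->
       Sset Z0 v p y (Zin z2) -> z1 = z2).

Definition regular_utility (R : realType) (n d3 : nat) (W : set 'rV[R]_n)
  (Z0 : set 'rV[R]_d3) (f : 'rV[R]_n -> 'rV[R]_d3 -> R) : Prop :=
  exists U : set ('rV[R]_n * 'rV[R]_d3),
    open U /\ W `*` Z0 `<=` U /\
    (forall q, U q -> {for q, continuous (fun q' : 'rV[R]_n * 'rV[R]_d3 => f q'.1 q'.2)}) /\
    (forall q, U q -> differentiable (fun x : 'rV[R]_n => f x q.2) (q.1)) /\
    (forall (h : 'rV[R]_n) q, U q ->
       {for q, continuous (fun q' : 'rV[R]_n * 'rV[R]_d3 =>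
                             'd (fun x : 'rV[R]_n => f x q'.2) (q'.1) h)}).

Definition twist (R : realType) (n d3 : nat) (W : set 'rV[R]_n)
  (Z0 : set 'rV[R]_d3) (f : 'rV[R]_n -> 'rV[R]_d3 -> R) : Prop :=
  forall x, W x -> forall z1 z2, Z0 z1 -> Z0 z2 ->
    (forall h : 'rV[R]_n, 'd (fun x' : 'rV[R]_n => f x' z1) x h =
                       'd (fun x' : 'rV[R]_n => f x' z2) x h) ->
    z1 = z2.

(* Main.v *)
(* If two maximizers z1, z2 exist at x, the twist condition makes some partial
   derivative of u(., z1) and u(., z2) at x differ, so the maximum of
   u(., z) - p(z) over z has a convex kink at x. Near x, any two points with
   maximizers near z1 and z2 satisfy
     |(D_x u(x, z2) - D_x u(x, z1)) . (x' - x'')| <= eps |x' - x''|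
   by the mean value theorem; hence these points lie on a Lipschitz graph over a
   coordinate hyperplane, which is Lebesgue null. A countable family of grid
   cells for (x, z1, z2) covers all kinks, so Rademacher's theorem is not needed.
   The supply side is the demand side for -v and -p. *)
Require Import Defs.
From HB Require Import structures.
From mathcomp Require Import all_boot all_order all_algebra.
From mathcomp Require Import all_classical all_reals all_analysis.
From mathcomp Require Import ring lra.
Import Order.TTheory GRing.Theory Num.Theory.
Import numFieldNormedType.Exports.
Set Implicit Arguments. Unset Strict Implicit. Unset Printing Implicit Defensive.
Local Open Scope classical_set_scope.
Local Open Scope ring_scope.

(** * Negligible sets of a finite Borel measure *)

Lemma open_borel (T : topologicalType) (A : set T) : open A -> borel A.
Proof. by move=> oA; exact: (@sub_sigma_algebra _ setT (@open T)). Qed.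

(** Countable additivity is applied to [A], the rest of [B] and empty sets; as the terms are
    nonnegative, [m A] stays below the limit [m B]. *)
Lemma fin_measure_on_sub0 (R : realType) (n : nat) (m : set 'rV[R]_n -> R)
  (A B : set 'rV[R]_n) : fin_measure_on (@borel _) m ->
  borel A -> borel B -> A `<=` B -> m B = 0 -> m A = 0.
Proof.
move=> [m0 [mge0 madd]] bA bB AB mB0.
pose T := g_sigma_algebraType (@open 'rV[R]_n).
have bBA : borel (B `\` A) by exact: (@measurableD _ T _ _ bB bA).
have b0 : borel (@set0 'rV[R]_n) by exact: (@measurable0 _ T).
have bF k : borel (bigcup2 A (B `\` A) k) by case: k => [|[|k]].
have tF : trivIset setT (bigcup2 A (B `\` A)).
  by rewrite -trivIset_bigcup2 setDE setICA setICr setI0.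
have := madd _ bF tF; rewrite bigcup2E setDUK// mB0 => sum0.
apply/eqP; rewrite eq_le mge0// andbT -(cvg_lim _ sum0)//.
apply: limr_ge; first by apply/cvg_ex; exists 0.
exists 1%N => // -[//|k _] /=.
by rewrite big_ord_recl /= lerDl sumr_ge0// => i _; exact: (mge0 _ (bF (bump 0 i))).
Qed.

(** Values of [m] carry meaning only on Borel sets, and the exceptional sets below are not shown to
    be Borel, hence the Borel cover [N]. *)
Definition measure_negligible (R : realType) (n : nat) (m : set 'rV[R]_n -> R)
  (A : set 'rV[R]_n) : Prop := exists N, borel N /\ m N = 0 /\ A `<=` N.

Lemma measure_negligible_bigcup (R : realType) (n : nat)
  (m : set 'rV[R]_n -> R) (I : countType) (F : I -> set 'rV[R]_n) :
  fin_measure_on (@borel _) m -> (forall i, measure_negligible m (F i)) ->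
  measure_negligible m (\bigcup_i F i).
Proof.
move=> mm negF; have [m0 [mge0 madd]] := mm.
pose T := g_sigma_algebraType (@open 'rV[R]_n).
have [N NP] := choice negF.
pose G k := if unpickle k is Some i then N i else set0.
have GP k : borel (G k) /\ m (G k) = 0.
  rewrite /G; case: unpickle => [i|]; first by have [? []] := NP i.
  by split=> //; exact: (@measurable0 _ T).
have bG k : borel (G k) by have [] := GP k.
have bD : forall k, borel (seqDU G k) by exact: (@seqDU_measurable _ T).
exists (\bigcup_k G k); split; [|split].
- by apply: (@bigcup_measurable _ T) => k _; exact: bG.
- have mD k : m (seqDU G k) = 0.
    apply: (fin_measure_on_sub0 mm (bD k) (bG k)); first exact: subset_seqDU.
    by have [] := GP k.
  have := madd _ bD (trivIset_seqDU G); rewrite -seqDU_bigcup_eq => sum0.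
  rewrite -(cvg_lim _ sum0)//; apply/lim_near_cst => //.
  by apply: nearW => k; apply: big1.
- move=> x [i _ Fix]; exists (pickle i) => //=.
  by rewrite /G pickleK; have [_ [_]] := NP i; apply.
Qed.

(** * Lebesgue-null sets: boxes, finite covers, Lipschitz graphs *)

Lemma closed_box (R : realType) (n : nat) (a b : 'rV[R]_n) :
  closed [set x : 'rV[R]_n | forall i, a ord0 i <= x ord0 i <= b ord0 i].
Proof.
have -> : [set x : 'rV[R]_n | forall i, a ord0 i <= x ord0 i <= b ord0 i] =
    \bigcap_i ((fun x : 'rV[R]_n => x ord0 i) @^-1` `[a ord0 i, b ord0 i]).
  apply/seteqP; split=> x /= xab i; first by move=> _ /=; rewrite in_itv /=.
  by have := xab i I; rewrite /= in_itv.
apply: closed_bigI => i _; apply: (continuous_closedP _).1; last exact: itv_closed.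
exact: coord_continuous.
Qed.

(** Intersecting box covers of volume at most 1/(k+1) over all k gives a Borel null set around [A],
    which itself may fail to be Borel. *)
Lemma lebesgue_null_negligible (R : realType) (n : nat)
  (m : set 'rV[R]_n -> R) (A : set 'rV[R]_n) :
  abs_cont_leb m -> lebesgue_null A -> measure_negligible m A.
Proof.
move=> acm nullA.
pose T := g_sigma_algebraType (@open 'rV[R]_n).
have [a aP] := choice (fun k : nat =>
  nullA k.+1%:R^-1 ltac:(by rewrite invr_gt0 ltr0n)).
have [b abP] := choice aP.
pose N := \bigcap_k \bigcup_l
  [set x : 'rV[R]_n | forall i, a k l ord0 i <= x ord0 i <= b k l ord0 i].
have bN : borel N.
  apply: (@bigcap_measurable _ T) => [|k _].
    by exists 0%N.
  apply: (@bigcup_measurable _ T) => l _.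
  rewrite -[X in measurable X]setCK; apply: (@measurableC _ T).
  by apply: open_borel; exact/closed_openC/closed_box.
exists N; split=> //; split; last first.
  by move=> x Ax k _; have [_ [+ _]] := abP k; apply.
apply: acm => // eps eps0.
have [k ke] := ltr_add_invr (y := 0) eps0; rewrite add0r in ke.
have [abk [_ sumk]] := abP k.
exists (a k), (b k); split=> //; split=> [x /(_ k I)//|M].
exact: le_trans (sumk M) (ltW ke).
Qed.

(* A coordinate [i] is needed: for [n = 0] boxes have volume [1] and nothing is null. *)
Lemma lebesgue_null_fin_cover (R : realType) (n : nat) (i : 'I_n)
  (S : set 'rV[R]_n) :
  (forall eps : R, 0 < eps -> exists (T : finType) (lo hi : T -> 'rV[R]_n),
    [/\ forall f j, lo f ord0 j <= hi f ord0 j,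
        forall x, S x ->
          exists f, forall j, lo f ord0 j <= x ord0 j <= hi f ord0 j
      & \sum_f \prod_(j < n) (hi f ord0 j - lo f ord0 j) <= eps]) ->
  lebesgue_null S.
Proof.
move=> cover eps /cover[T [lo [hi [lohi Sf sum_le]]]].
pose vol f := \prod_(j < n) (hi f ord0 j - lo f ord0 j).
have vol_ge0 f : 0 <= vol f by apply: prodr_ge0 => j _; rewrite subr_ge0.
exists (fun k => oapp lo 0 (@pickle_inv T k)), (fun k => oapp hi 0 (@pickle_inv T k)).
split; [|split].
- by move=> k j; case: pickle_inv => [f|//]; exact: lohi.
- move=> x /Sf[f fP]; exists (pickle f) => //= j.
  by rewrite pickleK_inv; exact: fP.
- move=> N; apply: le_trans sum_le.
  (* As a sum over [f], the volume at index [k] can be summed over [k] first; each [f] then counts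
     at most once. An index coding no [f] has the flat box at 0. *)
  have volE k : \prod_(j < n) (oapp hi 0 (@pickle_inv T k) ord0 j
      - oapp lo 0 (@pickle_inv T k) ord0 j) =
      \sum_f if pickle f == k then vol f else 0.
    rewrite -big_mkcond/=; have := @pickle_invK T k.
    case kT: pickle_inv => [f|] /= fk.
      rewrite (big_pred1 f)// => g /=; apply/eqP/eqP => [gk|->//].
      by apply: (pcan_inj pickleK_inv); rewrite gk.
    rewrite (bigD1 i)//= !mxE subrr mul0r big_pred0// => g.
    by apply/eqP => gk; move: kT; rewrite -gk pickleK_inv.
  under eq_bigr do rewrite volE.
  rewrite exchange_big/=; apply: ler_sum => f _.
  rewrite -big_mkcond/=; have [fN|fN] := ltnP (pickle f) N.
    by rewrite (big_pred1 (Ordinal fN))// => k; rewrite -val_eqE eq_sym.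
  rewrite big_pred0 ?vol_ge0// => k; apply/negP => /eqP fk.
  by have := ltn_ord k; rewrite -fk ltnNge fN.
Qed.

(** Cells are closed, so that the last one contains the right endpoint and [s = 0] is allowed. *)
Lemma grid_cell (R : realDomainType) (s t : R) (M : nat) :
  0 <= t <= s * M.+1%:R ->
  exists k : 'I_M.+1, s * k%:R <= t <= s * k%:R + s.
Proof.
move=> /andP[t0]; elim: M => [|M IH] tM.
  by exists ord0; rewrite mulr0 add0r t0/= -[s]mulr1.
have [/IH[k kt]|/ltW Mt] := leP t (s * M.+1%:R).
  by exists (widen_ord (leqnSn _) k).
by exists ord_max; rewrite Mt/= -[X in _ + X]mulr1 -mulrDr natr1.
Qed.

(* Over each grid cell of side [s] in the coordinates other than [i], [S] lies in a
   box of height [2 L s]. Cells are indexed by functions of all [n] coordinates, with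
   a flat box unless the [i]-th value is [0], so that the total volume is a product
   of sums. *)
Lemma lipschitz_graph_null (R : realType) (n : nat) (i : 'I_n) (L l : R)
  (a : 'rV[R]_n) (S : set 'rV[R]_n) :
  0 <= L -> 0 <= l ->
  (forall x, S x -> forall j, a ord0 j <= x ord0 j <= a ord0 j + l) ->
  (forall x x', S x -> S x' -> forall s : R, 0 <= s ->
     (forall j, j != i -> `|x' ord0 j - x ord0 j| <= s) ->
     `|x' ord0 i - x ord0 i| <= L * s) ->
  lebesgue_null S.
Proof.
move=> L0 l0 Sbox Scone; apply: (lebesgue_null_fin_cover i) => eps eps0.
pose C := 2 * (L * l) * \prod_(j < n | j != i) l.
have C0 : 0 <= C.
  by apply: mulr_ge0; [rewrite !mulr_ge0|apply: prodr_ge0].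
(* The cover will have total volume [C / M.+1%:R], so [M] is taken beyond [C / eps]. *)
pose M := Num.bound (C / eps); pose s := l / M.+1%:R.
have M0 : (0 : R) < M.+1%:R by rewrite ltr0n.
have s0 : 0 <= s by rewrite divr_ge0// ltW.
have sM : s * M.+1%:R = l by rewrite divfK// gt_eqF.
pose cell (f : {ffun 'I_n -> 'I_M.+1}) (x : 'rV[R]_n) := forall j,
  j != i -> a ord0 j + s * (f j)%:R <= x ord0 j <= a ord0 j + s * (f j)%:R + s.
(* A sample point of [S] in each cell centres the box: the other points of [S] there have height
   within [L * s] of it. Over cells missing [S] the value 0 is arbitrary. *)
have /choice[y yP] (f : {ffun 'I_n -> 'I_M.+1}) :
    exists yf : 'rV[R]_n, forall x, S x -> cell f x -> S yf /\ cell f yf.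
  have [[x [Sx fx]]|nS] := pselect (exists x, S x /\ cell f x).
    by exists x.
  by exists 0 => x Sx fx; exfalso; apply: nS; exists x.
exists {ffun 'I_n -> 'I_M.+1}.
exists (fun f : {ffun 'I_n -> 'I_M.+1} => \row_j (if j == i
  then if f i == ord0 then y f ord0 i - L * s else 0 else a ord0 j + s * (f j)%:R)).
exists (fun f : {ffun 'I_n -> 'I_M.+1} => \row_j (if j == i
  then if f i == ord0 then y f ord0 i + L * s else 0 else a ord0 j + s * (f j)%:R + s)).
have Ls0 : 0 <= L * s by exact: mulr_ge0.
split.
- move=> f j; rewrite !mxE; case: eqP => _; last by rewrite lerDl.
  by case: eqP => // _; lra.
- move=> x Sx.
  have /choice[k kP] j : exists k : 'I_M.+1,
      s * k%:R <= x ord0 j - a ord0 j <= s * k%:R + s.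
    apply: grid_cell; rewrite sM.
    by have /andP[] := Sbox x Sx j => ? ?; apply/andP; split; lra.
  pose f := [ffun j => if j == i then ord0 else k j].
  have fx : cell f x.
    move=> j ji; rewrite ffunE (negbTE ji).
    by have /andP[] := kP j => ? ?; apply/andP; split; lra.
  have [Sy fy] := yP f x Sx fx.
  exists f => j; rewrite !mxE; case: eqP => [->|/eqP ji]; last exact: fx.
  rewrite ffunE eqxx eqxx.
  have : `|x ord0 i - y f ord0 i| <= L * s.
    apply: Scone => // j' j'i; rewrite ler_norml.
    have /andP[? ?] := fx j' j'i; have /andP[? ?] := fy j' j'i.
    by apply/andP; split; lra.
  by rewrite ler_norml => /andP[? ?]; apply/andP; split; lra.
- pose g (j : 'I_n) (k : 'I_M.+1) : R :=
    if j == i then if k == ord0 then 2 * (L * s) else 0 else s.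
  rewrite (eq_bigr (fun f : {ffun 'I_n -> 'I_M.+1} => \prod_j g j (f j))); last first.
    move=> f _; apply: eq_bigr => j _; rewrite !mxE /g.
    by case: eqP => [->|_]; [case: eqP => _; ring|ring].
  rewrite -bigA_distr_bigA (bigD1 i)//=.
  rewrite [X in X * _](_ : _ = 2 * (L * s)); last first.
    by rewrite /g eqxx -big_mkcond (big_pred1 ord0).
  rewrite (eq_bigr (fun=> l)); last first.
    move=> j /negbTE ji; rewrite /g ji sumr_const card_ord.
    by rewrite -mulr_natr.
  have -> : 2 * (L * s) * \prod_(j < n | j != i) l = C / M.+1%:R.
    by rewrite /s /C; ring.
  rewrite ler_pdivrMr// -ler_pdivrMl// mulrC.
  have : C / eps < M%:R by apply: archi_boundP; rewrite divr_ge0// ltW.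
  by move/ltW/le_trans; apply; rewrite ler_nat.
Qed.

(** * First-order estimates along segments *)

Lemma mean_value_segment (R : realType) (n : nat) (g : 'rV[R]_n -> R)
  (x h : 'rV[R]_n) :
  (forall t : R, 0 <= t <= 1 -> differentiable g (x + t *: h)) ->
  exists2 t : R, 0 <= t <= 1 & g (x + h) - g x = 'd g (x + t *: h) h.
Proof.
move=> dg; pose phi (t : R) := g (x + t *: h).
(* Quotients of [phi] at [t] are those of [g] at [x + t *: h] in direction [h], which reduces the
   claim to one variable. *)
have quotE (t : R) :
    (fun k : R => k^-1 *: ((phi \o shift t) (k *: 1) - phi t)) =
    (fun k => k^-1 *: ((g \o shift (x + t *: h)) (k *: h) - g (x + t *: h))).
  apply/funext => k; congr (_ *: (g _ - _)) => /=.
  by rewrite addrCA scalerDl [k *: 1]mulr1.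
have dphi (t : R) : 0 <= t <= 1 -> is_derive t 1 phi ('d g (x + t *: h) h).
  move=> t01; split; first by rewrite /derivable quotE; apply/diff_derivable/dg.
  by rewrite /derive quotE -deriveE; [|exact: dg].
have [||t] := @MVT_segment R phi (fun t : R => 'd g (x + t *: h) h) 0 1 ler01.
- by move=> t; rewrite in_itv/= => /andP[t0 t1]; apply: dphi; rewrite !ltW.
- apply: derivable_within_continuous => t; rewrite in_itv/= => t01.
  by have [] := dphi t t01.
- rewrite in_itv/= => t01; rewrite /phi scale1r scale0r addr0 subr0 mulr1 => E.
  by exists t.
Qed.

Lemma diff_row_sum (R : realType) (n : nat) (g : 'rV[R]_n -> R)
  (x h : 'rV[R]_n) : 'd g x h = \sum_j h ord0 j * 'd g x (delta_mx ord0 j).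
Proof.
rewrite [in LHS](row_sum_delta h) linear_sum; apply: eq_bigr => j _.
by rewrite linearZ.
Qed.

(** Joint continuity keeps all partial derivatives within [eps] of their values at [(x0, z0)] on one
    ball, so the mean value theorem allows the gradient to be frozen there, uniformly in [z]. *)
Lemma uniform_increment (R : realType) (n m : nat)
  (f : 'rV[R]_n -> 'rV[R]_m -> R) (U : set ('rV[R]_n * 'rV[R]_m))
  (x0 : 'rV[R]_n) (z0 : 'rV[R]_m) (eps : R) :
  open U -> U (x0, z0) ->
  (forall q, U q -> differentiable (fun x : 'rV[R]_n => f x q.2) q.1) ->
  (forall (h : 'rV[R]_n) q, U q -> {for q, continuous (fun q' : 'rV[R]_n * 'rV[R]_m =>
     'd (fun x : 'rV[R]_n => f x q'.2) (q'.1) h)}) ->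
  0 < eps ->
  exists2 rho : R, 0 < rho & forall (x x' : 'rV[R]_n) (z : 'rV[R]_m),
    (forall j, `|x ord0 j - x0 ord0 j| < rho) ->
    (forall j, `|x' ord0 j - x0 ord0 j| < rho) ->
    (forall j, `|z ord0 j - z0 ord0 j| < rho) ->
    `|f x' z - f x z -
      \sum_j (x' ord0 j - x ord0 j) * 'd (f^~ z0) x0 (delta_mx ord0 j)|
      <= eps * \sum_j `|x' ord0 j - x ord0 j|.
Proof.
move=> oU U0 df cdf eps0.
pose D (j : 'I_n) (q : 'rV[R]_n * 'rV[R]_m) :=
  'd (fun x : 'rV[R]_n => f x q.2) (q.1) (delta_mx ord0 j).
have nearD : nbhs (x0, z0) [set q | forall j, `|D j (x0, z0) - D j q| < eps].
  have nearDj j : nbhs (x0, z0) [set q | `|D j (x0, z0) - D j q| < eps].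
    by have /cvgrPdist_lt := cdf (delta_mx ord0 j) _ U0; apply.
  exact: (filter_forall (nbhs_filter (x0, z0)) nearDj).
have [rho /= rho0 rhoP] :=
  (nbhs_ballP _ _).1 (filterI (open_nbhs_nbhs (conj oU U0)) nearD).
exists rho => // x x' z xr x'r zr.
have inball (t : R) : 0 <= t <= 1 -> ball (x0, z0) rho (x + t *: (x' - x), z).
  move=> /andP[t0 t1]; split; split=> // i j /=; rewrite (ord1 i) -ball_normE/=.
    rewrite !mxE distrC; have := xr j; have := x'r j.
    set a := x' _ _; set b := x _ _; set c := x0 _ _.
    have -> : b + t * (a - b) - c = t * (a - c) + (1 - t) * (b - c) by ring.
    move=> ac bc; apply: le_lt_trans (ler_normD _ _) _.
    rewrite !normrM (ger0_norm t0) [`|1 - t|]ger0_norm ?subr_ge0//.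
    (* Strictness comes from the term weighted by [t], so [t = 0] is treated apart. *)
    have [->|tn0] := eqVneq t 0; first by rewrite mul0r add0r subr0 mul1r.
    have tgt : 0 < t by rewrite lt_neqAle eq_sym tn0.
    have : t * `|a - c| < t * rho by rewrite ltr_pM2l.
    have : (1 - t) * `|b - c| <= (1 - t) * rho.
      by rewrite ler_wpM2l ?subr_ge0// ltW.
    lra.
  by rewrite distrC.
have dseg (t : R) : 0 <= t <= 1 -> differentiable (f^~ z) (x + t *: (x' - x)).
  by move=> /inball/rhoP[/df].
have [t t01 ft] := mean_value_segment dseg.
have [_ Dt] := rhoP _ (inball t t01).
move: ft; rewrite (addrC x) subrK => ->.
rewrite [X in X - _]diff_row_sum -sumrB mulr_sumr.
apply: le_trans (ler_norm_sum _ _ _) _.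
apply: ler_sum => j _; rewrite !mxE -mulrBr normrM mulrC.
by rewrite ler_wpM2r// distrC ltW//; exact: Dt.
Qed.

(** * Cone condition for points with nearby pairs of maximizers *)

(** Once the [i]-th term is isolated, the factor 1/2 lets half of [|c i| |h i|] be absorbed on the
    left; dividing what remains by [|c i| / 2] gives the constant. *)
Lemma steep_direction (R : realFieldType) (n : nat) (i : 'I_n)
  (c h : 'I_n -> R) (s : R) :
  c i != 0 -> (forall j, j != i -> `|h j| <= s) ->
  `|\sum_j h j * c j| <= `|c i| / 2 * \sum_j `|h j| ->
  `|h i| <= (\sum_(j < n | j != i) (1 + 2 * `|c j| / `|c i|)) * s.
Proof.
move=> ci0 hs; rewrite (bigD1 i)//= [in leRHS](bigD1 i)//= => sum_le.
have ci_gt0 : 0 < `|c i| by rewrite normr_gt0.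
pose T := \sum_(j < n | j != i) h j * c j.
have T_le : `|T| + `|c i| / 2 * (\sum_(j < n | j != i) `|h j|) <=
    `|c i| / 2 * ((\sum_(j < n | j != i) (1 + 2 * `|c j| / `|c i|)) * s).
  apply: le_trans (lerD (ler_norm_sum _ _ _) (lexx _)) _.
  rewrite mulr_suml !mulr_sumr -big_split/=; apply: ler_sum => j ji.
  have -> : `|c i| / 2 * ((1 + 2 * `|c j| / `|c i|) * s) =
      s * `|c j| + `|c i| / 2 * s by field; rewrite gt_eqF.
  by rewrite normrM lerD// ?ler_wpM2r ?ler_wpM2l ?hs// divr_ge0.
have : `|h i * c i| <= `|h i * c i + T| + `|T|.
  by rewrite -{1}[h i * c i](addrK T) ler_normB.
rewrite normrM => hc.
rewrite -(@ler_pM2l _ (`|c i| / 2)) ?divr_gt0//.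
move: sum_le T_le hc; rewrite -/T mulrDr [`|h i| * _]mulrC.
set a := `|c i| * `|h i|; have -> : `|c i| / 2 * `|h i| = a / 2 by rewrite /a; ring.
lra.
Qed.

(** [S1] and [S2] are the linear predictions of the increments near the two maximizers; each crossed
    inequality bounds their difference from one side, at the cost of two errors. *)
Lemma cross_gap (R : realFieldType) (a1 a1' a2 a2' S1 S2 e H : R) :
  `|a1 - S1| <= e / 4 * H -> `|a1' - S1| <= e / 4 * H ->
  `|a2 - S2| <= e / 4 * H -> `|a2' - S2| <= e / 4 * H ->
  a1 <= a2' -> a2 <= a1' -> `|S2 - S1| <= e / 2 * H.
Proof.
rewrite !ler_norml => /andP[? ?] /andP[? ?] /andP[? ?] /andP[? ?] ? ?.
by apply/andP; split; lra.
Qed.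

(* [w1', w2'] are the maximizers at [x']: comparing [w1] with [w2'] and [w2] with
   [w1'] bounds the variation of [f] from [x] to [x'] along the two gradients
   against each other, so [x' - x] is almost orthogonal to their difference. *)
Lemma cross_difference_steep (R : realType) (n m : nat)
  (f : 'rV[R]_n -> 'rV[R]_m -> R) (U : set ('rV[R]_n * 'rV[R]_m)) (i : 'I_n)
  (x0 : 'rV[R]_n) (z1 z2 : 'rV[R]_m) :
  open U -> U (x0, z1) -> U (x0, z2) ->
  (forall q, U q -> differentiable (fun x : 'rV[R]_n => f x q.2) q.1) ->
  (forall (h : 'rV[R]_n) q, U q ->
     {for q, continuous (fun q' : 'rV[R]_n * 'rV[R]_m =>
        'd (fun x : 'rV[R]_n => f x q'.2) (q'.1) h)}) ->
  'd (f^~ z1) x0 (delta_mx ord0 i) != 'd (f^~ z2) x0 (delta_mx ord0 i) ->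
  exists2 rho : R, 0 < rho & exists2 L : R, 0 <= L &
    forall (x x' : 'rV[R]_n) (w1 w2 w1' w2' : 'rV[R]_m),
    (forall j, `|x ord0 j - x0 ord0 j| < rho) ->
    (forall j, `|x' ord0 j - x0 ord0 j| < rho) ->
    (forall j, `|w1 ord0 j - z1 ord0 j| < rho) ->
    (forall j, `|w2 ord0 j - z2 ord0 j| < rho) ->
    (forall j, `|w1' ord0 j - z1 ord0 j| < rho) ->
    (forall j, `|w2' ord0 j - z2 ord0 j| < rho) ->
    f x' w1 - f x w1 <= f x' w2' - f x w2' ->
    f x' w2 - f x w2 <= f x' w1' - f x w1' ->
    forall s : R, 0 <= s ->
      (forall j, j != i -> `|x' ord0 j - x ord0 j| <= s) ->
      `|x' ord0 i - x ord0 i| <= L * s.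
Proof.
move=> oU U1 U2 df cdf.
pose c1 j := 'd (f^~ z1) x0 (delta_mx ord0 j).
pose c2 j := 'd (f^~ z2) x0 (delta_mx ord0 j).
rewrite eq_sym -subr_eq0 -[X in X - _]/(c2 i) -[X in _ - X]/(c1 i) => ci0.
(* Two errors of a quarter add up to the half that [steep_direction] absorbs. *)
have eps0 : 0 < `|c2 i - c1 i| / 4 by rewrite divr_gt0// normr_gt0.
have [r1 r10 inc1] := uniform_increment oU U1 df cdf eps0.
have [r2 r20 inc2] := uniform_increment oU U2 df cdf eps0.
exists (Num.min r1 r2); first by rewrite lt_min r10.
exists (\sum_(j < n | j != i) (1 + 2 * `|c2 j - c1 j| / `|c2 i - c1 i|)).
  by apply: sumr_ge0 => j _; rewrite addr_ge0// divr_ge0// mulr_ge0.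
move=> x x' w1 w2 w1' w2' xr x'r w1r w2r w1r' w2r' le12 le21 s s0 small.
have lt1 a : a < Num.min r1 r2 -> a < r1 by rewrite lt_min => /andP[].
have lt2 a : a < Num.min r1 r2 -> a < r2 by rewrite lt_min => /andP[].
apply: (steep_direction (h := fun j => x' ord0 j - x ord0 j)
  (c := fun j => c2 j - c1 j)) => //.
have -> : \sum_j (x' ord0 j - x ord0 j) * (c2 j - c1 j) =
    \sum_j (x' ord0 j - x ord0 j) * c2 j - \sum_j (x' ord0 j - x ord0 j) * c1 j.
  by rewrite -sumrB; apply: eq_bigr => j _; rewrite mulrBr.
have x1 j := lt1 _ (xr j); have x'1 j := lt1 _ (x'r j).
have x2 j := lt2 _ (xr j); have x'2 j := lt2 _ (x'r j).
have B1 := inc1 x x' w1 x1 x'1 (fun j => lt1 _ (w1r j)).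
have B1' := inc1 x x' w1' x1 x'1 (fun j => lt1 _ (w1r' j)).
have B2 := inc2 x x' w2 x2 x'2 (fun j => lt2 _ (w2r j)).
have B2' := inc2 x x' w2' x2 x'2 (fun j => lt2 _ (w2r' j)).
exact: (cross_gap B1 B1' B2 B2' le12 le21).
Qed.

(** * Countable decomposition by grid cells *)

(** Integer indices make the set of cells countable; [k] encodes the mesh 1/(k+1). *)
Definition grid_index (R : realType) (n k : nat) (x : 'rV[R]_n) :
  {ffun 'I_n -> int} := [ffun j => Num.floor (x ord0 j * k.+1%:R)].

Lemma grid_index_itv (R : realType) (n k : nat) (x : 'rV[R]_n) (j : 'I_n) :
  (grid_index k x j)%:~R / k.+1%:R <= x ord0 j
    < (grid_index k x j)%:~R / k.+1%:R + k.+1%:R^-1.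
Proof.
have k0 : (0 : R) < k.+1%:R by rewrite ltr0n.
have /andP[fl fu] := floor_itv (x ord0 j * k.+1%:R).
rewrite ffunE ler_pdivrMr// fl/=.
by move: fu; rewrite intrD mulr1z -ltr_pdivlMr// mulrDl mul1r.
Qed.

Lemma grid_index_eq (R : realType) (n k : nat) (x y : 'rV[R]_n) (rho : R) :
  k.+1%:R^-1 < rho -> grid_index k x = grid_index k y ->
  forall j, `|x ord0 j - y ord0 j| < rho.
Proof.
move=> krho xy j; have := grid_index_itv k x j; have := grid_index_itv k y j.
rewrite xy; move: krho.
move: (_ / k.+1%:R) => g; move: (k.+1%:R^-1) => e ke.
move=> /andP[? ?] /andP[? ?].
rewrite ltr_norml; apply/andP; split; lra.
Qed.

(** Adding the optimality inequalities of a maximizer at each of two points cancels the prices [p]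
    and [q]. *)
Lemma swap_le (R : realDomainType) (a b c d p q : R) :
  b - q <= a - p -> c - p <= d - q -> c - a <= d - b.
Proof. lra. Qed.

(** With [p] arbitrary and the maximum taken over [Z0] alone, this serves demand directly and supply
    after negation. *)
Lemma argmax_not_unique_negligible (R : realType) (n m : nat)
  (W : set 'rV[R]_n) (Z0 : set 'rV[R]_m) (mu : set 'rV[R]_n -> R)
  (f : 'rV[R]_n -> 'rV[R]_m -> R) (p : 'rV[R]_m -> R) :
  compact W -> fin_measure_on (@borel _) mu -> mu (~` W) = 0 ->
  abs_cont_leb mu -> regular_utility W Z0 f -> twist W Z0 f ->
  let argmax x z := Z0 z /\ forall z', Z0 z' -> f x z' - p z' <= f x z - p z in
  measure_negligible mu
    [set x | exists z1 z2, [/\ argmax x z1, argmax x z2 & z1 <> z2]].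
Proof.
move=> cW mm muW acm [U [oU [WU [_ [df cdf]]]]] tw argmax.
(* The pieces are countably many: coordinate, mesh, and grid cells of [x] and of
   two maximizers; only the pieces on which the cone condition holds are kept. *)
pose piece (k : nat) (a : {ffun 'I_n -> int}) (b1 b2 : {ffun 'I_m -> int}) :=
  [set x | [/\ W x, grid_index k x = a & exists z1 z2,
    [/\ argmax x z1, argmax x z2, grid_index k z1 = b1 & grid_index k z2 = b2]]].
pose steep (i : 'I_n) (S : set 'rV[R]_n) := exists2 L : R, 0 <= L &
  forall x x', S x -> S x' -> forall s : R, 0 <= s ->
    (forall j, j != i -> `|x' ord0 j - x ord0 j| <= s) ->
    `|x' ord0 i - x ord0 i| <= L * s.
(* [None] indexes the complement of [W], null by assumption. *)
pose I : countType := option ('I_n * nat * {ffun 'I_n -> int} *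
  {ffun 'I_m -> int} * {ffun 'I_m -> int})%type.
pose F (t : I) : set 'rV[R]_n := if t is Some (i, k, a, b1, b2)
  then [set x | piece k a b1 b2 x /\ steep i (piece k a b1 b2)] else ~` W.
have negF t : measure_negligible mu (F t).
  case: t => [[[[[i k] a] b1] b2]|] /=; last first.
    exists (~` W); split; last by split.
    apply: open_borel; apply: closed_openC.
    exact: (compact_closed (@norm_hausdorff _ _) cW).
  apply: (lebesgue_null_negligible acm).
  (* If the piece is not steep, [F t] is empty and the graph lemma applies vacuously. *)
  have [[L L0 LP]|nsteep] := pselect (steep i (piece k a b1 b2)); last first.
    apply: (@lipschitz_graph_null _ _ i 0 0 0) => // x; first by case.
    by move=> x' [].
  apply: (@lipschitz_graph_null _ _ i L k.+1%:R^-1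
    (\row_j ((a j)%:~R / k.+1%:R))) => //.
  - move=> x [[_ <- _] _] j; rewrite mxE.
    by have /andP[-> /ltW ->] := grid_index_itv k x j.
  - by move=> x x' [xP _] [x'P _]; exact: LP.
have [N [bN [muN FN]]] := measure_negligible_bigcup mm negF.
exists N; split=> //; split=> // x [z1 [z2 [xz1 xz2 z12]]]; apply: FN.
have [Wx|nWx] := pselect (W x); last by exists None.
have [Zz1 _] := xz1; have [Zz2 _] := xz2.
(* If all partial derivatives agreed, so would the differentials by linearity, and the twist would
   force [z1 = z2]. *)
have [i /eqP di] : exists i, 'd (f^~ z1) x (delta_mx ord0 i) <>
    'd (f^~ z2) x (delta_mx ord0 i).
  apply: contrapT => /forallNP same; apply: z12.
  apply: (tw x Wx z1 z2 Zz1 Zz2) => h; rewrite [LHS]diff_row_sum [RHS]diff_row_sum.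
  apply: eq_bigr => j _.
  exact: (congr1 (fun r => h ord0 j * r) (contrapT (same j))).
have [rho rho0 [L L0 LP]] := cross_difference_steep oU
  (WU (x, z1) (conj Wx Zz1)) (WU (x, z2) (conj Wx Zz2)) df cdf di.
(* With mesh below [rho], sharing a cell with [x], [z1] or [z2] means being [rho]-close to it. *)
have [k krho] := ltr_add_invr (y := 0) rho0; rewrite add0r in krho.
exists (Some (i, k, grid_index k x, grid_index k z1, grid_index k z2)) => //=.
split; first by split=> //; exists z1, z2.
exists L => // y y' [_ yx [w1 [w2 [yw1 yw2 w1z w2z]]]]
  [_ y'x [w1' [w2' [y'w1 y'w2 w1z' w2z']]]].
have close := grid_index_eq krho.
have [Zw1 w1max] := yw1; have [Zw2 w2max] := yw2.
have [Zw1' w1max'] := y'w1; have [Zw2' w2max'] := y'w2.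
apply: (LP y y' w1 w2 w1' w2'); try exact: close.
- exact: swap_le (w1max _ Zw2') (w2max' _ Zw1).
- exact: swap_le (w2max _ Zw1') (w1max' _ Zw2).
Qed.

(** * Supply side by negation *)

Lemma continuous_near_eq (T U : topologicalType) (D E : T -> U) (q : T) :
  {for q, continuous D} -> {near q, D =1 E} -> {for q, continuous E}.
Proof.
move=> cD DE; rewrite /prop_for /continuous_at -(nbhs_singleton DE : D q = E q).
exact: cvg_trans (near_eq_cvg DE) cD.
Qed.

Lemma regular_utilityN (R : realType) (n m : nat) (W : set 'rV[R]_n)
  (Z0 : set 'rV[R]_m) (f : 'rV[R]_n -> 'rV[R]_m -> R) :
  regular_utility W Z0 f -> regular_utility W Z0 (fun x z => - f x z).
Proof.
move=> [U [oU [WU [cf [df cdf]]]]]; exists U.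
split; first exact: oU.
split; first exact: WU.
split; first by move=> q Uq; exact: cvgN (cf q Uq).
split; first by move=> q Uq; exact: differentiableN (df q Uq).
move=> h q Uq.
(* [diffN] requires differentiability, known on [U], so the two differentials are identified only
   near [q]. *)
apply: (@continuous_near_eq _ _ (fun q' => - 'd (fun x => f x q'.2) (q'.1) h)).
  exact: cvgN (cdf h q Uq).
apply: filterS (open_nbhs_nbhs (conj oU Uq)) => q' Uq'.
exact: (congr1 (fun g => g h) (esym (diffN (df q' Uq')))).
Qed.

Lemma twistN (R : realType) (n m : nat) (W : set 'rV[R]_n)
  (Z0 : set 'rV[R]_m) (f : 'rV[R]_n -> 'rV[R]_m -> R) :
  regular_utility W Z0 f -> twist W Z0 f -> twist W Z0 (fun x z => - f x z).
Proof.
move=> [U [_ [WU [_ [df _]]]]] tw x Wx z1 z2 Zz1 Zz2 same.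
apply: (tw x Wx z1 z2 Zz1 Zz2) => h; apply: oppr_inj.
have d1 := diffN (df (x, z1) (WU (x, z1) (conj Wx Zz1))).
have d2 := diffN (df (x, z2) (WU (x, z2) (conj Wx Zz2))).
exact: etrans (esym (congr1 (fun g => g h) d1))
  (etrans (same h) (congr1 (fun g => g h) d2)).
Qed.

Theorem theorem7 (R : realType) (d1 d2 d3 : nat)
  (X : set 'rV[R]_d1) (Y : set 'rV[R]_d2) (Z0 : set 'rV[R]_d3)
  (mu : set 'rV[R]_d1 -> R) (nu : set 'rV[R]_d2 -> R)
  (u : 'rV[R]_d1 -> 'rV[R]_d3 -> R) (v : 'rV[R]_d2 -> 'rV[R]_d3 -> R) :
  compact X -> compact Y -> compact Z0 ->
  X !=set0 -> Y !=set0 ->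
  fin_measure_on (@borel _) mu -> mu (~` X) = 0 ->
  fin_measure_on (@borel _) nu -> nu (~` Y) = 0 ->
  regular_utility X Z0 u -> regular_utility Y Z0 v ->
  abs_cont_leb mu -> abs_cont_leb nu ->
  twist X Z0 u -> twist Y Z0 v ->
  forall (p : 'rV[R]_d3 -> R)
         (alpha : set ('rV[R]_d1 * Zpt 'rV[R]_d3) -> R)
         (beta : set ('rV[R]_d2 * Zpt 'rV[R]_d3) -> R),
    equilibrium X Y Z0 mu nu u v p alpha beta ->
    pure_equilibrium Z0 mu nu u v p.
Proof.
move=> cX cY _ _ _ mmu muX mnu nuY ru rv acmu acnu tu tv p alpha beta _.
split.
(* A maximizer over the whole of [Z] that lies in [Z0] also maximizes over [Z0]: only competitors
   [Zin z'] are tested. *)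
- have [N [bN [muN XN]]] :=
    argmax_not_unique_negligible p cX mmu muX acmu ru tu.
  exists N; split=> //; split=> // x nNx z1 z2 Zz1 Zz2 [_ D1] [_ D2].
  apply: contrapT => z12; apply: nNx; apply: XN; exists z1, z2.
  by split=> //; split=> // z' Zz'; [exact: (D1 (Zin z'))|exact: (D2 (Zin z'))].
- have [N [bN [nuN YN]]] := argmax_not_unique_negligible (fun z => - p z)
    cY mnu nuY acnu (regular_utilityN rv) (twistN rv tv).
  exists N; split=> //; split=> // y nNy z1 z2 Zz1 Zz2 [_ S1] [_ S2].
  apply: contrapT => z12; apply: nNy; apply: YN; exists z1, z2.
  split=> //; split=> // z' Zz'.
    by have := S1 (Zin z') Zz'; rewrite /=; lra.
  by have := S2 (Zin z') Zz'; rewrite /=; lra.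
Qed.
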